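(* Let $k\ge 3$, let $0\le q_j\le n_j$ be integers for $1\le j\le k$, and let $\{x_i^{(1)}\}_{i=q_1}^{n_1},\{x_i^{(2)}\}_{i=q_2}^{n_2},\dots,\{x_i^{(k)}\}_{i=q_k}^{n_k}$ be $k$ unimodal sequences of nonnegative numbers. For $1\le j\le k$ let $l_j,l_j+1,\dots,m_j$ (with $l_j\le m_j$) be the modes of $\{x_i^{(j)}\}$, let $r_j$ be a non-negative integer and let $a_j>0$. Then the sequence $\{\sum_{j=1}^k a_jx_{i-r_j}^{(j)}\}_i$ is unimodal if and only if its restriction to the indices $i$ with $\min_{1\le j\le k}\{l_j+r_j\}\le i\le \max_{1\le j\le k}\{m_j+r_j\}$ is unimodal.
   Context: A finite sequence of nonnegative numbers $\{a_i\}_{i=q}^{n}$ ($0\le q\le n$) is unimodal if there are indices $q\le l\le m\le n$ with $a_q\le a_{q+1}\le\cdots\le a_{l-1}<a_l=\cdots=a_m>a_{m+1}\ge\cdots\ge a_n$ (inequalities involving indices outside $[q,n]$ are omitted). The indices $l,l+1,\dots,m$ are called the modes of the sequence. Terms $x_i^{(j)}$ with index outside the given range are taken to be $0$, and the combined sequence is indexed by $\min_{j}\{q_j+r_j\}\le i\le \max_{j}\{n_j+r_j\}$. *)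

(* Defs.v *)
From mathcomp Require Import all_boot all_order all_algebra.

Set Implicit Arguments.
Unset Strict Implicit.
Unset Printing Implicit Defensive.

Import Order.TTheory GRing.Theory Num.Theory.

(* A finite sequence {a_i}_{i=q}^n is given by its bounds q, n and a function
   a : nat -> R of which only the values a i with q <= i <= n are relevant. *)

Definition nonneg_seq (R : realFieldType) (q n : nat) (a : nat -> R) : Prop :=
  forall i, q <= i <= n -> (0 <= a i)%R.

(* a_q <= ... <= a_(l-1) < a_l = ... = a_m > a_(m+1) >= ... >= a_n,
   without the inequalities that involve an index outside [q, n]. *)
Definition modes (R : realFieldType) (q n l m : nat) (a : nat -> R) : Prop :=
  [/\ q <= l, l <= m & m <= n] /\
  [/\ forall i, q <= i -> i.+1 < l -> (a i <= a i.+1)%R,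
      q < l -> (a l.-1 < a l)%R,
      forall i, l <= i -> i < m -> a i = a i.+1,
      m < n -> (a m.+1 < a m)%R &
      forall i, m < i -> i < n -> (a i.+1 <= a i)%R].

Definition unimodal (R : realFieldType) (q n : nat) (a : nat -> R) : Prop :=
  exists l m, modes q n l m a.

(* x_(i-r), read as 0 when i - r, as an integer, lies outside [q, n]; under
   the guard r <= i, so the truncated subtraction is the true one. *)
Definition shift_seq (R : realFieldType) (q n r : nat) (x : nat -> R)
    (i : nat) : R :=
  if q + r <= i <= n + r then x (i - r) else 0%R.

Definition max_over (k : nat) (F : 'I_k -> nat) : nat := \max_(j < k) F j.

(* nat has no top element to serve as the neutral element of minn; starting
   from the maximum does not affect the minimum when 0 < k. *)
Definition min_over (k : nat) (F : 'I_k -> nat) : nat :=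
  \big[minn / max_over F]_(j < k) F j.

(* Main.v *)
Require Import Defs.
From mathcomp Require Import all_boot all_order all_algebra.
From mathcomp Require Import zify.

Set Implicit Arguments.
Unset Strict Implicit.
Unset Printing Implicit Defensive.

Import Order.TTheory GRing.Theory Num.Theory.

(** Extended by zero, each summand is nondecreasing before its first mode and
    nonincreasing after its last one.  Hence the combination is nondecreasing
    before the smallest l_j + r_j and nonincreasing after the largest
    m_j + r_j.  Unimodality only asks for one index p such that the sequence
    climbs weakly up to p and descends weakly after it; such a peak for the
    middle part is a peak for the whole sequence, and a peak of the whole
    sequence can be moved to the nearest index of the middle part. *)

Lemma min_over_le (k : nat) (F : 'I_k -> nat) (j : 'I_k) : min_over F <= F j.
Proof.
rewrite /min_over; have: j \in index_enum 'I_k by rewrite mem_index_enum.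
elim: (index_enum 'I_k) => [//|i s IHs]; rewrite inE big_cons.
by case/predU1P => [<-|/IHs Fj]; rewrite geq_min ?leqnn ?Fj ?orbT.
Qed.

Lemma max_over_ge (k : nat) (F : 'I_k -> nat) (j : 'I_k) : F j <= max_over F.
Proof. exact: (leq_bigmax (F := F)). Qed.

Lemma leq_max_over (k : nat) (F G : 'I_k -> nat) :
  (forall j, F j <= G j) -> max_over F <= max_over G.
Proof. by move=> FG; apply: (big_ind2 leq) => // *; lia. Qed.

Lemma leq_min_over (k : nat) (F G : 'I_k -> nat) :
  (forall j, F j <= G j) -> min_over F <= min_over G.
Proof.
(* The two folds start from different values, [max_over F] and [max_over G], so the base case is a
   comparison of maxima. *)
move=> FG; apply: (big_ind2 leq) => // [|*]; first exact: leq_max_over.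
lia.
Qed.

Section Unimodality.
Variable R : realFieldType.
Implicit Types (a x : nat -> R) (q n l m p r i j : nat).

Lemma le_steps a q p :
    (forall i, q <= i -> i < p -> (a i <= a i.+1)%R) ->
  forall i j, q <= i -> i <= j -> j <= p -> (a i <= a j)%R.
Proof.
move=> a_up i j qi; elim: j => [|j IHj]; first by rewrite leqn0 => /eqP ->.
rewrite leq_eqVlt ltnS => /predU1P[-> //|ij] jp.
by apply: le_trans (IHj ij (ltnW jp)) (a_up j _ jp); apply: leq_trans ij.
Qed.

Lemma ge_steps a p n :
    (forall i, p <= i -> i < n -> (a i.+1 <= a i)%R) ->
  forall i j, p <= i -> i <= j -> j <= n -> (a j <= a i)%R.
Proof.
move=> a_dn i j pi ij jn; rewrite -lerN2.
by apply: (le_steps (a := fun i => - a i)%R) pi ij jn => h *; rewrite lerN2 a_dn.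
Qed.

Lemma modes_le q n l m a : modes q n l m a ->
  forall i, q <= i -> i < l -> (a i <= a i.+1)%R.
Proof.
case=> _ [a_up a_l _ _ _] i qi; rewrite leq_eqVlt => /predU1P[il|]; last exact: a_up.
by move: a_l; rewrite -il /= ltnS => /(_ qi)/ltW.
Qed.

Lemma modes_ge q n l m a : modes q n l m a ->
  forall i, m <= i -> i < n -> (a i.+1 <= a i)%R.
Proof.
case=> _ [_ _ _ a_m a_dn] i; rewrite leq_eqVlt => /predU1P[<- /a_m/ltW //|].
exact: a_dn.
Qed.

(** Only weak inequalities occur, so a peak need not be unique and can be moved. *)
Definition peak q n p a : Prop :=
  [/\ q <= p <= n,
      forall i, q <= i -> i < p -> (a i <= a i.+1)%R &
      forall i, p <= i -> i < n -> (a i.+1 <= a i)%R].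

(** The first mode is a peak. Conversely, the modes are the plateau of value [a p] around a peak
    [p]; the strict inequalities at its ends come from its being as long as possible. *)
Lemma unimodal_peak q n a : unimodal q n a <-> exists p, peak q n p a.
Proof.
split=> [[l [m lm_a]]|[p [/andP[qp pn] a_up a_dn]]].
  have [[ql lm mn] [_ _ a_eq _ _]] := lm_a.
  exists l; split; [lia | exact: modes_le lm_a | move=> i li].
  by case: (ltnP i m) => [/(a_eq i li) -> //|/(modes_ge lm_a)]; apply.
have le_p i : q <= i <= p -> (a i <= a p)%R.
  by case/andP=> qi ip; apply: le_steps a_up _ _ qi ip _.
have ge_p i : p <= i <= n -> (a i <= a p)%R.
  by case/andP=> pi; apply: ge_steps a_dn _ _ _ pi.
pose L i := (q <= i <= p) && (a i == a p).
have exL : exists i, L i by exists p; rewrite /L qp leqnn eqxx.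
pose M i := (p <= i <= n) && (a i == a p).
have exM : exists i, M i by exists p; rewrite /M pn leqnn eqxx.
have leM i : M i -> i <= n by case/andP=> /andP[].
case: (ex_minnP exL) => l /andP[/andP[ql lp] /eqP al] l_min.
case: (ex_maxnP exM leM) => m /andP[/andP[pm mn] /eqP am] m_max.
(* On each side of [p], monotonicity squeezes [a i] between the value at the plateau's end and
   [a p], which are equal. *)
have a_const i : l <= i <= m -> a i = a p.
  case/andP=> li im; apply/eqP; rewrite eq_le; case: (leqP i p) => ip.
    by rewrite le_p -?al ?(le_steps a_up) //; lia.
  by rewrite ge_p -?am ?(ge_steps a_dn) //; lia.
exists l, m; split; first by split=> //; lia.
split=> [i qi il|ql'|i li im|mn'|i mi i_n].
- by apply: a_up => //; lia.
- rewrite al lt_neqAle le_p ?andbT; last lia.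
  by apply/negP => al'; have := l_min l.-1; rewrite /L al' andbT; lia.
- by rewrite !a_const //; lia.
- rewrite am lt_neqAle ge_p ?andbT; last lia.
  by apply/negP => am'; have := m_max m.+1; rewrite /M am' andbT; lia.
- by apply: a_dn => //; lia.
Qed.

Lemma unimodal_restrict q n l m a :
    q <= l -> l <= m -> m <= n ->
    (forall i, i < l -> (a i <= a i.+1)%R) ->
    (forall i, m <= i -> (a i.+1 <= a i)%R) ->
  unimodal q n a <-> unimodal l m a.
Proof.
move=> ql lm mn a_up a_dn; rewrite !unimodal_peak.
split=> [[p [qpn p_up p_dn]]|[p [lpm p_up p_dn]]].
  (* This is [p] clamped to [[l, m]]. If [p < l], the climb up to [l] is vacuous and the descent is
     inherited; [p > m] is symmetric. *)
  exists (maxn l (minn p m)).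
  by split=> [|i ? ?|i ? ?]; [lia | apply: p_up; lia | apply: p_dn; lia].
exists p; split=> [|i _ ip|i pi _]; first lia.
- by case: (ltnP i l) => [/a_up //|li]; apply: p_up.
- by case: (leqP m i) => [/a_dn //|im]; apply: p_dn.
Qed.

(** Nonnegativity makes the entry from the zero padding into the support a climb; inside,
    [i < l + r] keeps [i.+1] in the support. *)
Lemma shift_seq_le q n l m r x i :
    nonneg_seq q n x -> modes q n l m x -> i < l + r ->
  (shift_seq q n r x i <= shift_seq q n r x i.+1)%R.
Proof.
move=> x_ge0 lm_x il; have [[ql lm mn] _] := lm_x; rewrite /shift_seq.
case: ifP => [i_in|_]; last by case: ifP => // ?; apply: x_ge0; lia.
rewrite ifT; last lia.
by rewrite subSn; [apply: (modes_le lm_x); lia | lia].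
Qed.

Lemma shift_seq_ge q n l m r x i :
    nonneg_seq q n x -> modes q n l m x -> m + r <= i ->
  (shift_seq q n r x i.+1 <= shift_seq q n r x i)%R.
Proof.
move=> x_ge0 lm_x mi; have [[ql lm mn] _] := lm_x; rewrite /shift_seq.
(* The split is on [i.+1] here: if it lies in the support, so does [i], because
   [q + r <= m + r <= i]. *)
case: ifP => [i_in|_]; last by case: ifP => // ?; apply: x_ge0; lia.
rewrite ifT; last lia.
by rewrite subSn; [apply: (modes_ge lm_x); lia | lia].
Qed.

End Unimodality.

Theorem theorem2p3 (R : realFieldType) (k : nat) (hk : 3 <= k)
    (q n : 'I_k -> nat) (hqn : forall j, q j <= n j)
    (x : 'I_k -> nat -> R)
    (hx0 : forall j, nonneg_seq (q j) (n j) (x j))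
    (l m : 'I_k -> nat)
    (hx : forall j, modes (q j) (n j) (l j) (m j) (x j))
    (r : 'I_k -> nat)
    (a : 'I_k -> R) (ha : forall j, (0 < a j)%R) :
  let y := fun i : nat =>
    (\sum_(j < k) a j * shift_seq (q j) (n j) (r j) (x j) i)%R in
  unimodal (min_over (fun j => q j + r j)) (max_over (fun j => n j + r j)) y
  <->
  unimodal (min_over (fun j => l j + r j)) (max_over (fun j => m j + r j)) y.
Proof.
move=> y; have qlmn j : [/\ q j <= l j, l j <= m j & m j <= n j].
  by have [] := hx j.
apply: unimodal_restrict => [||| i il | i mi].
- by apply: leq_min_over => j; rewrite leq_add2r; case: (qlmn j).
(* Any single index [j] separates the two bounds, through [l j + r j <= m j + r j]; index 0 is
   taken. *)
- pose j : 'I_k := Ordinal (ltn_trans (isT : 0 < 2) hk).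
  apply: (leq_trans (min_over_le _ j)).
  apply: leq_trans (max_over_ge _ j).
  by rewrite leq_add2r; case: (qlmn j).
- by apply: leq_max_over => j; rewrite leq_add2r; case: (qlmn j).
- apply: ler_sum => j _; rewrite ler_pM2l //.
  apply: (shift_seq_le (hx0 j) (hx j)).
  exact: leq_trans il (min_over_le _ j).
- apply: ler_sum => j _; rewrite ler_pM2l //.
  apply: (shift_seq_ge (hx0 j) (hx j)).
  exact: leq_trans (max_over_ge _ j) mi.
Qed.
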